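(* Let $H$ be an $m$-partite $m$-uniform hypergraph of complexity $M$ on the vertex classes $V_1,\dots,V_m$, and let $w$ be a nonnegative vertex weighting with $w(V_j)=1$ for every $j$ and $w(x)\le\lambda$ for every vertex $x$. Then $$w(H)\le C_{M,m}\lambda^{1/2^{m-1}},$$ where $w(H)=\sum_{\{x_1,\dots,x_m\}\in E(H)}w(x_1)\cdots w(x_m)$ and $C_{M,m}$ depends only on $M$ and $m$.
   Context: Hypergraph complexity: a $1$-uniform hypergraph has complexity $M$ if it has at most $M$ edges; for $k>1$, a $k$-uniform $k$-partite hypergraph $H$ with vertex classes $V_1,\dots,V_k$ has complexity $M$ if $H=H_1\cup\dots\cup H_M$ such that for each $i$, the common link in $H_i$ of any two elements $x,y\in V_1$ (the hypergraph of all sets $e$ such that $e\cup\{x\}$ and $e\cup\{y\}$ are both edges of $H_i$) is a $(k-1)$-uniform $(k-1)$-partite hypergraph on $V_2,\dots,V_k$ of complexity $M$. *)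

(* Defs.v *)
From mathcomp Require Import all_boot all_order all_algebra.

Set Implicit Arguments.
Unset Strict Implicit.
Unset Printing Implicit Defensive.

Import Order.TTheory GRing.Theory Num.Theory.

Section Hypergraph.
Variable T : finType.
Implicit Types (H : {set {set T}}) (Vs : seq {set T}).

Definition uniform (k : nat) H : Prop := {in H, forall e : {set T}, #|e| = k}.

Definition partite Vs H : Prop :=
  {in H, forall e : {set T}, e \subset \bigcup_(A <- Vs) A /\
     {in Vs, forall A : {set T}, #|e :&: A| <= 1}}.

(* If [x != y] lie in the same class of a [k]-uniform [k]-partite [H], then no
   [e] below meets that class (such an [e] with [x] or [y] added would meet it
   twice), so the common link is (k-1)-uniform and (k-1)-partite on the
   remaining classes. *)
Definition common_link H (x y : T) : {set {set T}} :=
  [set e : {set T} | (x |: e \in H) && (y |: e \in H)].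

(* [Vs] lists the vertex classes. The two elements [x], [y] of the first class
   are distinct, and the same [M] is used at every level. *)
Fixpoint has_complexity (M : nat) Vs H : Prop :=
  match Vs with
  | [::] => False
  | [:: _] => #|H| <= M
  | A :: (_ :: _) as Vs' =>
      exists Hs : 'I_M -> {set {set T}},
        H = \bigcup_(i < M) Hs i /\
        forall (i : 'I_M) (x y : T), x \in A -> y \in A -> x != y ->
          has_complexity M Vs' (common_link (Hs i) x y)
  end.

Local Open Scope ring_scope.

Definition hweight (R : pzRingType) (w : T -> R) H : R :=
  \sum_(e in H) \prod_(x in e) w x.

End Hypergraph.

(* Main.v *)
(** Fix a piece [H] of the decomposition, all of whose common links of pairs
    [x != y] in the first class [A] have small complexity, and write
    [w(H) = \sum_f w(f) g(f)], where [f] runs over the transversals of the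
    other classes and [g(f)] is the weight of [{x \in A : x |: f \in H}]. The
    transversals have total weight at most 1, so by Cauchy-Schwarz
    [w(H)^2 <= \sum_f w(f) g(f)^2], which is the sum of [w(x) w(y) w(f)] over
    [x], [y] in [A] and [f] in their common link. The diagonal [x = y]
    contributes at most [lambda], and the rest is bounded by induction on the
    number of classes; each square root halves the exponent of [lambda]. *)
Require Import Defs.
From mathcomp Require Import all_boot all_order all_algebra.
From mathcomp Require Import reals exp.
From mathcomp Require Import ring lra.

Set Implicit Arguments.
Unset Strict Implicit.
Unset Printing Implicit Defensive.

Import Order.TTheory GRing.Theory Num.Theory.
Local Open Scope ring_scope.

(** * Edges as transversals of the classes, and links of vertices *)

Section Transversals.
Variable T : finType.
Implicit Types (H G : {set {set T}}) (Vs : seq {set T}) (A B e f : {set T}).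

(** The condition [x \notin f] makes [f] and [x |: f] determine each other, so members of the link
    correspond exactly to edges through [x]. *)
Definition link H (x : T) : {set {set T}} := [set f : {set T} | x \notin f & x |: f \in H].

Lemma card_transversal_le Vs e :
  e \subset \bigcup_(A <- Vs) A ->
  {in Vs, forall A, (#|e :&: A| <= 1)%N} -> (#|e| <= size Vs)%N.
Proof.
elim: Vs e => [|A Vs IH] e; first by rewrite big_nil subset0 => /eqP->; rewrite cards0.
rewrite big_cons => sub le1 /=.
rewrite -(cardsID A e) -add1n leq_add ?le1 ?mem_head //.
apply: IH => [|B BVs].
  apply/subsetP => x; rewrite inE => /andP[xA xe].
  by move/subsetP: sub => /(_ x xe); rewrite inE (negbTE xA).
apply: leq_trans (le1 B _); last by rewrite inE BVs orbT.
by rewrite subset_leq_card // setSI // subsetDl.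
Qed.

(** An edge missing [A] would lie in the other [size Vs] classes and meet each at most once, hence
    have one element too few. *)
Lemma card_transversal1 A Vs H e :
  uniform (size Vs).+1 H -> partite (A :: Vs) H -> e \in H -> #|e :&: A| = 1%N.
Proof.
move=> uH pH eH; have [sub le1] := pH e eH.
apply/eqP; rewrite eqn_leq le1 ?mem_head //= lt0n cards_eq0.
apply/negP => /eqP eA0.
have : (#|e| <= size Vs)%N.
  apply: card_transversal_le => [|B BVs]; last by apply: le1; rewrite inE BVs orbT.
  apply/subsetP => x xe; move/subsetP: sub => /(_ x xe).
  rewrite big_cons inE => /orP[xA|//].
  by have := in_set0 x; rewrite -eA0 inE xe xA.
by rewrite uH // ltnn.
Qed.

Lemma uniform_sub k G H : G \subset H -> uniform k H -> uniform k G.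
Proof. by move=> /subsetP sGH uH e /sGH /uH. Qed.

Lemma partite_sub Vs G H : G \subset H -> partite Vs H -> partite Vs G.
Proof. by move=> /subsetP sGH pH e /sGH /pH. Qed.

Lemma uniform_link k H x : uniform k.+1 H -> uniform k (link H x).
Proof.
by move=> uH f; rewrite inE => /andP[xf /uH]; rewrite cardsU1 xf add1n => -[].
Qed.

Lemma partite_link A Vs H x :
  x \in A -> partite (A :: Vs) H -> partite Vs (link H x).
Proof.
move=> xA pH f; rewrite inE => /andP[xf /pH[sub le1]]; split.
  apply/subsetP => y yf.
  have : y \in \bigcup_(B <- A :: Vs) B by apply: (subsetP sub); rewrite !inE yf orbT.
  rewrite big_cons inE => /orP[yA|//].
  (* If [y] were in [A], the edge [x |: f] would meet [A] in both [x] and [y]. *)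
  have : (#|[set x; y]| <= 1)%N.
    apply: leq_trans (le1 A (mem_head _ _)); apply: subset_leq_card.
    by apply/subsetP => z; rewrite !inE => /orP[]/eqP->; rewrite ?eqxx ?xA ?yf ?yA ?orbT.
  rewrite cards2; case: eqP => // exy; by rewrite exy yf in xf.
move=> B BVs; apply: leq_trans (le1 B _); last by rewrite inE BVs orbT.
by apply: subset_leq_card; rewrite setSI // subsetUr.
Qed.

(** Transfers the complexity hypothesis to the intersections of links produced by Cauchy-Schwarz. A
    member of the common link cannot contain [x] or [y], or some edge would meet [A] twice. *)
Lemma common_link_link A Vs H x y : partite (A :: Vs) H ->
  x \in A -> y \in A -> x != y -> common_link H x y = link H x :&: link H y.
Proof.
move=> pH xA yA xy; apply/setP => f; rewrite !inE.
have twice u v : u \in A -> v \in A -> u != v -> v |: f \in H -> u \notin f.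
  move=> uA vA uv /pH[_ le1]; apply/negP => uf.
  have : (#|[set u; v]| <= 1)%N.
    apply: leq_trans (le1 A (mem_head _ _)); apply: subset_leq_card.
    by apply/subsetP => z; rewrite !inE => /orP[]/eqP->; rewrite ?eqxx ?uA ?uf ?vA ?orbT.
  by rewrite cards2 uv.
apply/andP/andP => [[xH yH]|[/andP[_ xH] /andP[_ yH]]] //.
by rewrite xH yH (twice x y) // (twice y x) // eq_sym.
Qed.

End Transversals.

(** * Weights of links and the Cauchy-Schwarz step *)

Section Weights.
Variables (R : realDomainType) (T : finType) (w : T -> R).
Implicit Types (H G : {set {set T}}) (Vs : seq {set T}) (A B e f : {set T}).

(** Each edge has exactly one vertex in [A], so it is counted once when the edges are sorted by that
    vertex. *)
Lemma hweight_link A Vs H :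
  uniform (size Vs).+1 H -> partite (A :: Vs) H ->
  hweight w H = \sum_(x in A) w x * hweight w (link H x).
Proof.
move=> uH pH; rewrite /hweight.
transitivity (\sum_(e in H) \sum_(x in e :&: A) \prod_(z in e) w z).
  apply: eq_bigr => e eH.
  by rewrite sumr_const (card_transversal1 uH pH eH).
rewrite (exchange_big_dep (mem A)) /=; last by move=> e x _; rewrite inE => /andP[].
apply: eq_bigr => x xA; rewrite mulr_sumr.
rewrite (reindex_onto (fun f => x |: f) (fun e => e :\ x)) /=; last first.
  by move=> e /andP[_]; rewrite inE => /andP[xe _]; rewrite setD1K.
apply: eq_big => [f|f].
  rewrite !inE eqxx xA /= andbT andbC; congr (_ && _).
  apply/eqP/idP => [<-|xf]; last exact: setU1K.
  by rewrite !inE eqxx.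
case/andP=> _ /eqP <-; rewrite big_setU1 ?setD11 //=.
Qed.

Hypothesis w0 : forall x, 0 <= w x.

Lemma prodw_ge0 e : 0 <= \prod_(x in e) w x.
Proof. by apply: prodr_ge0. Qed.

Lemma hweight_bigcup (M : nat) (Hs : 'I_M -> {set {set T}}) :
  hweight w (\bigcup_(i < M) Hs i) <= \sum_(i < M) hweight w (Hs i).
Proof.
rewrite /hweight; under [leRHS]eq_bigr do rewrite big_mkcond.
rewrite exchange_big /= [leLHS]big_mkcond /=; apply: ler_sum => e _.
have nn i : 0 <= (if e \in Hs i then \prod_(x in e) w x else 0).
  by case: ifP; rewrite ?prodw_ge0.
case: bigcupP => [[i _ ei]|_]; last by apply: sumr_ge0.
by rewrite (bigD1 i) //= ei lerDl; apply: sumr_ge0.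
Qed.

Lemma hweight_le1 Vs H :
  uniform (size Vs) H -> partite Vs H ->
  {in Vs, forall A, \sum_(x in A) w x = 1} -> hweight w H <= 1.
Proof.
elim: Vs H => [|A Vs IH] H uH pH w1.
  have sH : H \subset [set set0].
    by apply/subsetP => e /uH /eqP; rewrite inE cards_eq0.
  rewrite /hweight; move: sH; rewrite subset1 => /orP[]/eqP->.
    by rewrite big_set1 big_set0.
  by rewrite big_set0.
rewrite (hweight_link uH pH) -(w1 A (mem_head _ _)).
apply: ler_sum => x xA; apply: ler_piMr => //.
apply: IH; [exact: uniform_link | exact: partite_link xA pH |].
by move=> B BVs; apply: w1; rewrite inE BVs orbT.
Qed.

(* Cauchy-Schwarz for a subprobability [p]: the variance of [g] is >= 0. *)
Lemma sqr_mean_le (I : finType) (P : pred I) (p g : I -> R) :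
  (forall i, 0 <= p i) -> \sum_(i | P i) p i <= 1 ->
  (\sum_(i | P i) p i * g i) ^+ 2 <= \sum_(i | P i) p i * g i ^+ 2.
Proof.
move=> p0 p1; set S := \sum_(i | P i) p i * g i.
have : 0 <= \sum_(i | P i) p i * (g i - S) ^+ 2.
  by apply: sumr_ge0 => i _; rewrite mulr_ge0 ?sqr_ge0.
under eq_bigr => i _ do
  have -> : p i * (g i - S) ^+ 2
    = p i * g i ^+ 2 - S *+ 2 * (p i * g i) + S ^+ 2 * p i by ring.
rewrite big_split /= sumrB -!mulr_sumr -/S => h.
have : S ^+ 2 * \sum_(i | P i) p i <= S ^+ 2 by rewrite ler_piMr ?sqr_ge0.
by nra.
Qed.

Lemma sqr_hweight_le A Vs H :
  uniform (size Vs).+1 H -> partite (A :: Vs) H ->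
  {in Vs, forall B, \sum_(x in B) w x = 1} ->
  hweight w H ^+ 2 <=
  \sum_(x in A) \sum_(y in A) w x * w y * hweight w (link H x :&: link H y).
Proof.
move=> uH pH w1.
(* Only transversals in some link matter; as [G] is itself uniform and partite on [Vs], their
   weights form a subprobability. *)
pose G := \bigcup_(x in A) link H x.
have GP f : f \in G -> exists2 x, x \in A & f \in link H x.
  by case/bigcupP => x; exists x.
have G1 : hweight w G <= 1.
  apply: (@hweight_le1 Vs) => // f /GP[x xA].
    exact: uniform_link.
  exact: partite_link xA pH _.
pose g f := \sum_(x in A) w x * (f \in link H x)%:R.
have -> : hweight w H = \sum_(f in G) (\prod_(z in f) w z) * g f.
  rewrite (hweight_link uH pH) /hweight.
  under [RHS]eq_bigr do rewrite mulr_sumr.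
  rewrite exchange_big /=; apply: eq_bigr => x xA.
  rewrite mulr_sumr big_mkcond [RHS]big_mkcond /=; apply: eq_bigr => f _.
  case: ifPn => [fx|_]; last by rewrite !mulr0 if_same.
  by rewrite ifT ?mulr1 1?mulrC //; apply/bigcupP; exists x.
apply: le_trans (sqr_mean_le _ _ G1) _; first by move=> f; apply: prodw_ge0.
(* The two sides are equal: expand [g f ^+ 2] over pairs [x], [y] and sum over [f] first; the two
   indicators select the intersection of the links. *)
rewrite le_eqVlt; apply/orP; left; apply/eqP.
transitivity (\sum_(f in G) \sum_(x in A) \sum_(y in A) (\prod_(z in f) w z) *
    ((w x * (f \in link H x)%:R) * (w y * (f \in link H y)%:R))).
  apply: eq_bigr => f _; rewrite expr2 /g big_distrlr mulr_sumr.
  by apply: eq_bigr => x _; rewrite mulr_sumr.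
rewrite exchange_big /=; apply: eq_bigr => x xA.
rewrite exchange_big /=; apply: eq_bigr => y yA.
rewrite /hweight mulr_sumr big_mkcond [RHS]big_mkcond /=; apply: eq_bigr => f _.
rewrite in_setI; case: (boolP (f \in link H x)) => [fx|_]; last first.
  by rewrite !(mulr0, mul0r) if_same.
case: (boolP (f \in link H y)) => [fy|_]; last by rewrite !mulr0 if_same.
rewrite ifT; first by rewrite !mulr1 mulrC.
by apply/bigcupP; exists x.
Qed.

(** For fixed [x], the term [y = x] costs at most [w x <= lambda], and the other [y], of total
    weight at most 1, cost at most [b]. *)
Lemma sum_sum_offdiag_le A (F : T -> T -> R) (lambda b : R) :
  \sum_(x in A) w x = 1 -> {in A, forall x, w x <= lambda} -> 0 <= b ->
  (forall x, x \in A -> F x x <= 1) ->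
  (forall x y, x \in A -> y \in A -> x != y -> F x y <= b) ->
  \sum_(x in A) \sum_(y in A) w x * w y * F x y <= lambda + b.
Proof.
move=> w1 wl b0 F1 Fb.
rewrite -[leRHS]mul1r -[in leRHS]w1 mulr_suml; apply: ler_sum => x xA.
under eq_bigr do rewrite -mulrA; rewrite -mulr_sumr; apply: ler_wpM2l => //.
rewrite (bigD1 x) //=; apply: lerD.
  by apply: le_trans (wl x xA); apply: ler_piMr; rewrite ?F1.
rewrite -[leRHS]mul1r -w1 mulr_suml [leRHS](bigD1 x) //=.
apply: ler_wpDl; first by rewrite mulr_ge0.
apply: ler_sum => y /andP[yA yx]; apply: ler_wpM2l => //.
by rewrite Fb // eq_sym.
Qed.

End Weights.

(** * Powers of [lambda] and the induction on the number of classes *)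

Lemma powR_half_sqr (R : realType) (a : R) (n : nat) :
  (a `^ (1 / 2 ^+ n.+1)) ^+ 2 = a `^ (1 / 2 ^+ n).
Proof.
rewrite -powR_mulrn ?powR_ge0 // -powRrM; congr (_ `^ _).
by rewrite exprS; field; rewrite expf_neq0 // pnatr_eq0.
Qed.

(** Each further square root can only increase a number in the unit interval. *)
Lemma le_powR_half (R : realType) (a : R) (n : nat) :
  0 <= a <= 1 -> a <= a `^ (1 / 2 ^+ n).
Proof.
case/andP=> a0 a1; elim: n => [|n IH]; first by rewrite expr0 divr1 powRr1.
apply: le_trans IH _; rewrite -powR_half_sqr expr2.
apply: ler_piMl; first exact: powR_ge0.
apply: (@le_trans _ _ (1 `^ (1 / 2 ^+ n.+1))); last by rewrite powR1.
by apply: ge0_ler_powR; rewrite ?nnegrE // divr_ge0 // exprn_ge0.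
Qed.

(* The classes need not be disjoint: an [m]-edge contained in their union and
   meeting each of them at most once already meets each exactly once. *)
Lemma hweight_complexity_le (R : realType) (M n : nat) :
  exists2 C : R, 0 <= C &
    forall (T : finType) (Vs : seq {set T}) (H : {set {set T}})
           (w : T -> R) (lambda : R),
      size Vs = n.+1 -> uniform n.+1 H -> partite Vs H ->
      has_complexity M Vs H ->
      (forall x, 0 <= w x) ->
      {in Vs, forall A : {set T}, \sum_(x in A) w x = 1} ->
      {in Vs, forall A : {set T}, {in A, forall x, w x <= lambda}} ->
      0 <= lambda <= 1 ->
      hweight w H <= C * lambda `^ (1 / 2 ^+ n).
Proof.
elim: n => [|n [C C0 IH]].
  (* With one class there are at most [M] edges, each a single vertex of weight at most [lambda]. *)
  exists M%:R; first exact: ler0n.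
  move=> T [|A [|//]] // H w l _ uH pH /= cH w0 w1 wl /andP[l0 l1].
  rewrite expr0 divr1 powRr1 //.
  apply: (@le_trans _ _ (\sum_(e in H) l)); last first.
    by rewrite sumr_const -[leLHS]mulr_natl ler_wpM2r // ler_nat.
  apply: ler_sum => e eH.
  have /eqP/cards1P[x ex] := uH e eH.
  rewrite ex big_set1; apply: (wl A (mem_head _ _)).
  have [/subsetP/(_ x) sub _] := pH e eH.
  by move: sub; rewrite big_seq1; apply; rewrite ex inE.
(* There are [M] pieces, each of squared weight at most [l + C * P <= (1 + C) * P <= (1 + C) ^+ 2 *
   P]; bounding by the square keeps roots out of the constant. *)
exists (M%:R * (1 + C)); first by rewrite mulr_ge0 // addr_ge0.
move=> T [|A Vs] // H w l [sVs]; rewrite -sVs => uH pH cH w0 w1 wl l01.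
have [Hs [defH cHs]] : exists Hs : 'I_M -> {set {set T}},
    H = \bigcup_(i < M) Hs i /\
    forall i x y, x \in A -> y \in A -> x != y ->
      has_complexity M Vs (common_link (Hs i) x y).
  by case: (Vs) sVs cH => [|B Vs'].
have sub i : Hs i \subset H by rewrite defH; apply: (bigcup_max i).
rewrite defH; apply: le_trans (hweight_bigcup w0 Hs) _.
rewrite -mulrA -[X in X%:R * _]card_ord mulr_natl -sumr_const.
apply: ler_sum => i _.
have uHi := uniform_sub (sub i) uH; have pHi := partite_sub (sub i) pH.
have w1' : {in Vs, forall B : {set T}, \sum_(x in B) w x = 1}.
  by move=> B BVs; apply: w1; rewrite inE BVs orbT.
have uL x y : uniform (size Vs) (link (Hs i) x :&: link (Hs i) y).
  exact: uniform_sub (subsetIl _ _) (uniform_link uHi).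
have pL x y : x \in A -> partite Vs (link (Hs i) x :&: link (Hs i) y).
  move=> xA; exact: partite_sub (subsetIl _ _) (partite_link xA pHi).
rewrite sVs -(@ler_pXn2r _ 2) ?nnegrE //; last 2 first.
- by apply: sumr_ge0 => e _; apply: prodw_ge0.
- by rewrite mulr_ge0 ?powR_ge0 ?addr_ge0.
rewrite exprMn powR_half_sqr; set P := l `^ _.
have P0 : 0 <= P by exact: powR_ge0.
have lP : l <= P by exact: le_powR_half.
apply: le_trans (sqr_hweight_le w0 uHi pHi w1') _.
apply: (@le_trans _ _ (l + C * P)); last by nra.
apply: sum_sum_offdiag_le => //.
- by apply: w1; rewrite mem_head.
- by apply: wl; rewrite mem_head.
- by rewrite mulr_ge0.
- by move=> x xA; apply: (hweight_le1 w0 (uL x x) (pL x x xA) w1').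
move=> x y xA yA xy.
apply: (IH T Vs) => //; first by rewrite -sVs.
- exact: pL.
- by rewrite -(common_link_link pHi) //; apply: cHs.
by move=> B BVs; apply: wl; rewrite inE BVs orbT.
Qed.

(** * Reduction to globally nonnegative weights and [lambda] at most 1 *)

Theorem theorem5p1 (R : realType) (M m : nat) (hm : (0 < m)%N) :
  exists C : R,
    forall (T : finType) (V : m.-tuple {set T}) (H : {set {set T}})
           (w : T -> R) (lambda : R),
      (forall i j : 'I_m, i != j -> [disjoint tnth V i & tnth V j]) ->
      uniform m H -> partite V H -> has_complexity M V H ->
      (forall (j : 'I_m) (x : T), x \in tnth V j -> 0 <= w x) ->
      (forall j : 'I_m, \sum_(x in tnth V j) w x = 1) ->
      (forall (j : 'I_m) (x : T), x \in tnth V j -> w x <= lambda) ->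
      hweight w H <= C * (lambda `^ (1 / 2 ^+ m.-1)).
Proof.
case: m hm => [//|n] _; have [C C0 HC] := hweight_complexity_le R M n.
exists C => T V H w l _ uH pH cH w0 w1 wl.
have normw (j : 'I_n.+1) x : x \in tnth V j -> `|w x| = w x.
  by move=> /w0; apply: ger0_norm.
(* A class of total weight 1 is nonempty, so [l] bounds some nonnegative weight. *)
have l0 : 0 <= l.
  have [x xV|V0] := pickP (mem (tnth V ord0)).
    exact: le_trans (w0 _ _ xV) (wl _ _ xV).
  by have := w1 ord0; rewrite big_pred0 // => /eqP; rewrite eq_sym oner_eq0.
(* Hence [Num.min l 1] still bounds the weights on the classes. *)
have wle1 (j : 'I_n.+1) x : x \in tnth V j -> w x <= 1.
  move=> xV; rewrite -(w1 j) (bigD1 x) //= lerDl.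
  by apply: sumr_ge0 => y /andP[yV _]; apply: w0 yV.
(* [w] is unconstrained outside the classes, and [lambda] may exceed 1. *)
have -> : hweight w H = hweight (fun x => `|w x|) H.
  apply: eq_bigr => e eH; apply: eq_bigr => x xe.
  have [/subsetP/(_ x xe) xV _] := pH e eH.
  move: xV; rewrite big_tuple => /bigcupP[j _ xj].
  by rewrite (normw j).
have m01 : 0 <= Num.min l 1 <= 1 by rewrite le_min l0 ler01 ge_min lexx orbT.
apply: (@le_trans _ _ (C * Num.min l 1 `^ (1 / 2 ^+ n))).
  apply: (HC T V) => //; first by rewrite size_tuple.
    move=> A /tnthP[j ->]; rewrite -(w1 j); apply: eq_bigr => x xV.
    exact: normw xV.
  move=> A /tnthP[j ->] x xV.
  by rewrite (normw j) // le_min (wl j) // (wle1 j).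
apply: ler_wpM2l => //; apply: ge0_ler_powR; rewrite ?nnegrE //.
- by rewrite divr_ge0 // exprn_ge0.
- by case/andP: m01.
- by rewrite ge_min lexx.
Qed.
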